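(* Let $n>1$. Any program in the computational model described in the context that, for every input word $x$ of length $n$, outputs $\nu(x)$ requires $\min(\nu(x),n-\nu(x))$ steps in the worst case under the unit cost measure, for $\nu(x)\neq n/2$; that is, for every $k$ with $0\le k\le n$ and $k\neq n/2$ there is an input $x$ with $\nu(x)=k$ on which the program executes at least $\min(k,n-k)$ operations.
   Context: $\nu(x)$ denotes the number of ones in the binary word $x$. Computational model: a program operates on unsigned integer variables, each holding an $n$-bit word. The input word $x$ is stored in a variable $x$; all other variables are initially zero. The available operations are increment and decrement (modulo $2^n$, so incrementing the all-ones word gives zero and decrementing zero gives the all-ones word), bitwise logical AND and OR, and assignment. The only constant available in assignments and comparisons is zero. Control flow may depend on comparisons (of the numerical values) between variables or with zero, and the program outputs the value of a variable. Each operation costs one unit (unit cost measure). *)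

(* Defs.v *)
From mathcomp Require Import all_boot.
Set Implicit Arguments.
Unset Strict Implicit.
Unset Printing Implicit Defensive.

(* Bit 0 is the least significant one. *)
Definition word (n : nat) := n.-tuple bool.

Definition nu n (x : word n) : nat := count_mem true x.

Definition uint n (x : word n) : nat := \sum_(i < n) tnth x i * 2 ^ i.

(* The n-bit word of value m modulo 2 ^ n. *)
Definition word_of_nat n (m : nat) : word n := [tuple odd (m %/ 2 ^ i) | i < n].

Definition word0 n : word n := [tuple false | i < n].

Definition word_inc n (x : word n) : word n := word_of_nat n (uint x).+1.

(* Adding 2 ^ n first keeps the truncated predecessor away from zero. *)
Definition word_dec n (x : word n) : word n := word_of_nat n (2 ^ n + uint x).-1.

Definition word_and n (x y : word n) : word n :=
  [tuple tnth x i && tnth y i | i < n].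

Definition word_or n (x y : word n) : word n :=
  [tuple tnth x i || tnth y i | i < n].

(* A finite program mentions only finitely many variables, so indexing them by
   nat puts no a priori bound on their number. Variable 0 holds the input. *)
Definition var := nat.

Inductive operand := Zero | Var of var.

Inductive operation :=
  | Inc of var
  | Dec of var
  | And of var & var
  | Or of var & var
  | Copy of operand.

Inductive cmp_op := CmpLt | CmpLe | CmpEq.

(* [Op d o] stores the result of [o] in variable [d]; an in-place increment is
   [Op d (Inc d)]. The last two arguments of [Branch] are the addresses of the
   next instruction when the comparison succeeds and when it fails. *)
Inductive instr :=
  | Op of var & operation
  | Branch of cmp_op & operand & operand & nat & nat
  | Output of var.

Definition program := seq instr.

Definition store (n : nat) := var -> word n.

Definition init n (x : word n) : store n :=
  fun v => if v == 0 then x else word0 n.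

Definition update n (s : store n) (d : var) (w : word n) : store n :=
  fun v => if v == d then w else s v.

Definition eval_operand n (s : store n) (a : operand) : word n :=
  match a with
  | Zero => word0 n
  | Var v => s v
  end.

Definition eval_operation n (s : store n) (o : operation) : word n :=
  match o with
  | Inc v => word_inc (s v)
  | Dec v => word_dec (s v)
  | And u v => word_and (s u) (s v)
  | Or u v => word_or (s u) (s v)
  | Copy a => eval_operand s a
  end.

Definition eval_comparison n (c : cmp_op) (x y : word n) : bool :=
  match c with
  | CmpLt => uint x < uint y
  | CmpLe => uint x <= uint y
  | CmpEq => uint x == uint y
  end.

(* [exec P pc s t w]: started at address [pc] with store [s], program [P] halts
   with output [w] after exactly [t] operations. Branches and the final output
   are not charged, and a run reaching an address outside [P] has no output. *)
Inductive exec n (P : program) : nat -> store n -> nat -> word n -> Prop :=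
  | ExecOp pc s t w d o :
      onth P pc = Some (Op d o) ->
      exec P pc.+1 (update s d (eval_operation s o)) t w ->
      exec P pc s t.+1 w
  | ExecBranch pc s t w c a b l1 l2 :
      onth P pc = Some (Branch c a b l1 l2) ->
      exec P (if eval_comparison c (eval_operand s a) (eval_operand s b)
              then l1 else l2) s t w ->
      exec P pc s t w
  | ExecOutput pc s v :
      onth P pc = Some (Output v) ->
      exec P pc s 0 (s v).

Definition runs n (P : program) (x : word n) (t : nat) (w : word n) : Prop :=
  exec P 0 (init x) t w.

Lemma exec_deterministic n (P : program) pc (s : store n) t1 w1 t2 w2 :
  exec P pc s t1 w1 -> exec P pc s t2 w2 -> t1 = t2 /\ w1 = w2.
Proof.
move=> H1; elim: H1 t2 w2 => {pc s t1 w1}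
  [pc s t w d o E _ IH|pc s t w c a b l1 l2 E _ IH|pc s v E] t2 w2 H2;
  inversion H2 as [pc' s' t' w' d' o' E' R'|pc' s' t' w' c' a' b' l1' l2' E' R'
                  |pc' s' v' E'];
  subst; move: (E'); rewrite E => -[] // *; subst => //.
- by have [-> ->] := IH _ _ R'.
- exact: IH.
Qed.

Definition computes_nu n (P : program) : Prop :=
  forall x : word n, exists t w, runs P x t w /\ uint w = nu x.

(* Main.v *)
(** The input carries [min k (n - k)] low-order pairs of bits 0, 1 and is constant
    above them. A carry that enters a pair untouched so far dies inside it, so
    after [t] operations every variable agrees, above the lowest [t] pairs, with
    the constant 0, the constant 1 or the input. As long as one pair is
    untouched, the input lies strictly between the two constants there, so all
    comparisons, and hence the whole run, are the same when the top bit of the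
    input is flipped. An output that is constant above the touched pairs misses the
    flip; one that agrees there with the input has its top bit set for one of the
    two inputs, so it is at least [2 ^ n.-1 >= n] and too large. *)

Require Import Defs.
From mathcomp Require Import all_boot.
From mathcomp Require Import zify.

Set Implicit Arguments.
Unset Strict Implicit.
Unset Printing Implicit Defensive.

(** * Bits of a word under increment and decrement *)

Lemma odd_binary_digit n (b : nat -> bool) i :
  odd ((\sum_(j < n) b j * 2 ^ j) %/ 2 ^ i) = (i < n) && b i.
Proof.
elim: n b i => [|n IH] b i; first by rewrite big_ord0 div0n.
rewrite big_ord_recl expn0 muln1.
have -> : \sum_(j < n) b (lift ord0 j) * 2 ^ lift ord0 j =
    (\sum_(j < n) b j.+1 * 2 ^ j) * 2.
  by rewrite big_distrl; apply: eq_bigr => j _; rewrite /= -mulnA -expnSr.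
case: i => [|i]; first by rewrite divn1 oddD oddM andbF addbF; case: (b 0).
rewrite expnS divnMA addnC divnMDl // (@divn_small (b 0)) ?addn0; last by case: (b 0).
by rewrite (IH (fun j => b j.+1)).
Qed.

Lemma uint_nth n (x : word n) : uint x = \sum_(j < n) nth false x j * 2 ^ j.
Proof. by apply: eq_bigr => j _; rewrite (tnth_nth false). Qed.

Lemma odd_uint_div n (x : word n) (i : 'I_n) : odd (uint x %/ 2 ^ i) = tnth x i.
Proof. by rewrite uint_nth odd_binary_digit ltn_ord (tnth_nth false). Qed.

Lemma dvdn_exp2S i m : (2 ^ i.+1 %| m) = (2 ^ i %| m) && ~~ odd (m %/ 2 ^ i).
Proof.
have p0 : 0 < 2 ^ i by rewrite expn_gt0.
apply/idP/andP => [/dvdnP[q ->]|[/dvdnP[q ->]]].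
  by rewrite expnS mulnA mulnK // dvdn_mull // oddM andbF.
by rewrite mulnK // expnS -dvdn2 => /dvdnP[r ->]; rewrite -mulnA dvdn_mull.
Qed.

Lemma dvdn_exp2P i m :
  reflect (forall j, j < i -> ~~ odd (m %/ 2 ^ j)) (2 ^ i %| m).
Proof.
elim: i => [|i IH]; first by rewrite dvd1n; constructor.
rewrite dvdn_exp2S; apply: (iffP andP) => [[/IH H oi] j|H].
  by rewrite ltnS leq_eqVlt => /predU1P[->|/H].
by split; [apply/IH => j ji; apply: H; rewrite ltnS ltnW | apply: H].
Qed.

(** Adding one carries through the low [i] bits, leaving zeros there, exactly when all of them are
    ones. *)
Lemma dvdn_exp2_succP i m :
  reflect (forall j, j < i -> odd (m %/ 2 ^ j)) (2 ^ i %| m.+1).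
Proof.
elim: i => [|i IH]; first by rewrite dvd1n; constructor.
rewrite dvdn_exp2S divnS ?expn_gt0 // oddD; apply: (iffP andP) => [[d]|H].
  rewrite d negbK => oi j; rewrite ltnS leq_eqVlt => /predU1P[->//|].
  by move/IH: d; apply.
have d : 2 ^ i %| m.+1 by apply/IH => j ji; apply: H; rewrite ltnS ltnW.
by rewrite d /= negbK; split=> //; apply: H.
Qed.

(** For [e = true] this is the carry that an increment sends into bit [i]; for [e = false], the
    borrow of a decrement. *)
Definition carry n (e : bool) (x : word n) (i : nat) : bool :=
  [forall j : 'I_n, (j < i) ==> (tnth x j == e)].

Lemma tnth_word_inc n (x : word n) (i : 'I_n) :
  tnth (word_inc x) i = tnth x i (+) carry true x i.
Proof.
rewrite tnth_mktuple divnS ?expn_gt0 // oddD odd_uint_div addbC; congr (_ (+) _).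
rewrite oddb; apply/dvdn_exp2_succP/forallP => [H j|H j ji].
  by apply/implyP => /H; rewrite odd_uint_div => ->.
have jn := ltn_trans ji (ltn_ord i).
by move: (H (Ordinal jn)); rewrite ji /= -odd_uint_div => /eqP.
Qed.

Lemma tnth_word_dec n (x : word n) (i : 'I_n) :
  tnth (word_dec x) i = tnth x i (+) carry false x i.
Proof.
rewrite tnth_mktuple; set M := (_ + _).-1.
have MS : M.+1 = 2 ^ n + uint x by rewrite /M prednK // addn_gt0 expn_gt0.
(* Adding [2 ^ n] preserves the bits below [n]: for [j < n] it raises the quotient by the even
   number [2 ^ (n - j)]. *)
have bitM (j : nat) : j < n -> odd (M.+1 %/ 2 ^ j) = odd (uint x %/ 2 ^ j).
  move=> jn; rewrite MS -{1}(subnK (ltnW jn)) expnD divnMDl ?expn_gt0 //.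
  by rewrite oddD oddX /= subn_eq0 leqNgt jn.
have <- : (2 ^ i %| M.+1) = carry false x i.
  apply/dvdn_exp2P/forallP => [H j|H j ji].
    apply/implyP => /H; rewrite bitM // odd_uint_div => /negbTE ->.
    exact: eqxx.
  have jn := ltn_trans ji (ltn_ord i).
  by move: (H (Ordinal jn)); rewrite ji bitM //= -odd_uint_div => /eqP ->.
rewrite -odd_uint_div -bitM // divnS ?expn_gt0 // oddD oddb.
by case: (_ %| _) (odd _) => [] [].
Qed.

Lemma carry_mem n e (x : word n) (i j : 'I_n) :
  j < i -> tnth x j != e -> carry e x i = false.
Proof.
by move=> ji xj; apply/negbTE/forallPn; exists j; rewrite ji (negbTE xj).
Qed.

Lemma eq_carry n e (x y : word n) (p : nat) :
  (forall j : 'I_n, j < p -> tnth x j = tnth y j) -> carry e x p = carry e y p.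
Proof.
by move=> xy; apply: eq_forallb => j; case: (ltnP j p) => //= jp; rewrite xy.
Qed.

Lemma carry_const n e (x : word n) (p i : nat) :
    p <= i -> (forall j : 'I_n, p <= j -> tnth x j = e) ->
  carry e x i = carry e x p.
Proof.
move=> pi xe; apply: eq_forallb => j; case: (ltnP j p) => jp.
  by rewrite (leq_trans jp pi).
by rewrite xe // eqxx; case: (j < i).
Qed.

(** * Comparison of values through the high-order bits *)

Lemma uint_split n (x : word n) p : uint x =
  \sum_(j < n | j < p) tnth x j * 2 ^ j + \sum_(j < n | p <= j) tnth x j * 2 ^ j.
Proof.
rewrite /uint (bigID (fun j : 'I_n => j < p)) /=; congr (_ + _).
by apply: eq_bigl => j; rewrite -leqNgt.
Qed.

Lemma sum_exp2 p : (\sum_(j < p) 2 ^ j).+1 = 2 ^ p.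
Proof.
elim: p => [|p IH]; first by rewrite big_ord0.
by rewrite big_ord_recr /= -addSn IH expnS; lia.
Qed.

Lemma uint_low n (x : word n) p :
  p <= n -> \sum_(j < n | j < p) tnth x j * 2 ^ j < 2 ^ p.
Proof.
move=> pn; rewrite -sum_exp2 ltnS (big_ord_widen _ (fun j => 2 ^ j) pn).
by apply: leq_sum => j _; case: (tnth x j); rewrite ?mul1n.
Qed.

(** Above [p] the word [y] gains at least [2 ^ i >= 2 ^ p], which outweighs whatever [x] holds below
    [p]. *)
Lemma uint_lt n (x y : word n) p (i : 'I_n) :
    p <= i -> ~~ tnth x i -> tnth y i ->
    (forall j : 'I_n, p <= j -> tnth x j -> tnth y j) ->
  uint x < uint y.
Proof.
move=> pi xi yi xy; rewrite (uint_split x p) (uint_split y p).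
apply: (@leq_trans (2 ^ p + \sum_(j < n | p <= j) tnth x j * 2 ^ j)).
  by rewrite ltn_add2r uint_low // (leq_trans pi) // ltnW.
apply: leq_trans (leq_addl _ _); rewrite (bigD1 i) //= [leqRHS](bigD1 i) //=.
rewrite yi (negbTE xi) mul0n add0n mul1n leq_add ?leq_exp2l //.
apply: leq_sum => j /andP[pj _]; rewrite leq_mul2r; apply/orP; right.
by move: (xy j pj); case: (tnth x j) => // ->.
Qed.

Lemma uint_ge_bit n (x : word n) (i : 'I_n) : tnth x i -> 2 ^ i <= uint x.
Proof. by move=> xi; rewrite /uint (bigD1 i) //= xi mul1n leq_addr. Qed.

(** * Lockstep runs on two inputs *)

(* [None] stands for the input word itself, [Some c] for the constant [c]. *)
Definition alike n (x x' : word n) (p : nat) (f : option bool) (a a' : word n) :=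
  (forall i : 'I_n, i < p -> tnth a i = tnth a' i) /\
  (forall i : 'I_n, p <= i ->
     tnth a i = odflt (tnth x i) f /\ tnth a' i = odflt (tnth x' i) f).

Definition alike_store n (x x' : word n) (p : nat) (s s' : store n) :=
  forall v, exists f, alike x x' p f (s v) (s' v).

(** The shapes are ordered as constant 0, input, constant 1, and the hypotheses put [f] strictly
    below [g]. The default plays the input bit; the value [f == Some false] makes the gap visible at
    that bit. *)
Lemma odflt_lt (f g : option bool) :
    (f == Some false) || (g == Some true) -> f != g ->
  [/\ odflt (f == Some false) f = false, odflt (f == Some false) g &
      forall c, odflt c f -> odflt c g].
Proof. by case: f g => [[]|] [[]|]. Qed.

Section TwoInputs.

Variables (n m : nat) (x x' : word n).
Hypothesis m_small : 2 * m <= n.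
Hypothesis x_pairs : forall i : 'I_n, i < 2 * m -> tnth x i = odd i.
Hypothesis x'_pairs : forall i : 'I_n, i < 2 * m -> tnth x' i = odd i.

(** The bits from [p] to [q] lie inside the pairs, where the two inputs coincide. *)
Lemma alike_widen p q f a a' :
  p <= q -> q <= 2 * m -> alike x x' p f a a' -> alike x x' q f a a'.
Proof.
move=> pq qm [lo hi]; split=> i iq; last exact: hi (leq_trans pq iq).
case: (ltnP i p) => [/lo //|/hi[-> ->]].
by have im := leq_trans iq qm; rewrite x_pairs // x'_pairs.
Qed.

Lemma alike0 p c : alike x x' p (Some c) [tuple c | i < n] [tuple c | i < n].
Proof. by split=> i _; rewrite !tnth_mktuple. Qed.

Lemma alike_input : alike x x' 0 None x x'.
Proof. by []. Qed.

Lemma alike_and p f g a a' b b' :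
    alike x x' p f a a' -> alike x x' p g b b' ->
  exists h, alike x x' p h (word_and a b) (word_and a' b').
Proof.
move=> [alo ahi] [blo bhi].
(* The meet of [f] and [g] in the order 0, input, 1; for [word_or] it is the join. *)
exists (match f with
        | Some false => Some false | Some true => g
        | None => if g is Some false then Some false else None end).
split=> i ip; rewrite !tnth_mktuple; first by rewrite alo // blo.
have [-> ->] := ahi i ip; have [-> ->] := bhi i ip.
by case: f g {ahi bhi} => [[]|] [[]|] //=; rewrite ?andbT ?andbF ?andbb.
Qed.

Lemma alike_or p f g a a' b b' :
    alike x x' p f a a' -> alike x x' p g b b' ->
  exists h, alike x x' p h (word_or a b) (word_or a' b').
Proof.
move=> [alo ahi] [blo bhi].
exists (match f with
        | Some true => Some true | Some false => g
        | None => if g is Some true then Some true else None end).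
split=> i ip; rewrite !tnth_mktuple; first by rewrite alo // blo.
have [-> ->] := ahi i ip; have [-> ->] := bhi i ip.
by case: f g {ahi bhi} => [[]|] [[]|] //=; rewrite ?orbT ?orbF ?orbb.
Qed.

Lemma fresh_pair j : j < m -> forall c, exists i : 'I_n,
  [/\ 2 * j <= i, i < 2 * j.+1, tnth x i = c & tnth x' i = c].
Proof.
move=> jm c; have ltn_i : 2 * j + c < n by case: c; lia.
exists (Ordinal ltn_i).
have c_lt : 2 * j + c < 2 * m by case: (c); lia.
rewrite x_pairs ?x'_pairs //= oddD oddM oddb.
by split=> //; case: (c); lia.
Qed.

(** If [a] is constantly [e] above the touched pairs, the carry entering there reaches every higher
    bit, and it is the same in both runs because the low bits agree. Otherwise pair [j] contains a
    bit different from [e], which stops the carry in both runs. *)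
Lemma alike_carry j e f a a' b b' :
    j < m -> alike x x' (2 * j) f a a' ->
    (forall i, tnth b i = tnth a i (+) carry e a i) ->
    (forall i, tnth b' i = tnth a' i (+) carry e a' i) ->
  exists h, alike x x' (2 * j.+1) h b b'.
Proof.
move=> jm aa' bE b'E; have [lo0 hi0] := aa'.
have [lo hi] : alike x x' (2 * j.+1) f a a' by apply: alike_widen aa'; lia.
exists (if f == Some e then Some (e (+) carry e a (2 * j)) else f).
split=> i ij.
  rewrite bE b'E lo //; congr (_ (+) _); apply: eq_carry => l li.
  exact: lo (ltn_trans li ij).
have [ai a'i] := hi i ij; rewrite bE b'E.
case: eqP => [fe|/eqP fe].
  have ae (l : 'I_n) : 2 * j <= l -> tnth a l = e by move/hi0 => []; rewrite fe.
  have a'e (l : 'I_n) : 2 * j <= l -> tnth a' l = e by move/hi0 => []; rewrite fe.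
  have ji : 2 * j <= i by lia.
  rewrite ae ?a'e //= (carry_const ji ae) (carry_const ji a'e).
  by rewrite -(eq_carry e lo0).
have [l [jl lj xl x'l]] := fresh_pair jm (~~ e).
have [al a'l] := hi0 l jl; have li := leq_trans lj ij.
have fl : odflt (~~ e) f != e.
  by move: f fe {aa' lo0 hi0 lo hi ai a'i al a'l} => [[]|]; case: (e).
by rewrite !(carry_mem li) ?al ?a'l ?xl ?x'l // !addbF.
Qed.

Lemma alike_operand p s s' a :
    alike_store x x' p s s' ->
  exists f, alike x x' p f (eval_operand s a) (eval_operand s' a).
Proof.
by case: a => [|v] ss'; [exists (Some false); apply: alike0 | apply: ss'].
Qed.

Lemma alike_operation j s s' o :
    j < m -> alike_store x x' (2 * j) s s' ->
  exists f, alike x x' (2 * j.+1) f (eval_operation s o) (eval_operation s' o).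
Proof.
move=> jm ss'.
have widen a a' : (exists f, alike x x' (2 * j) f a a') ->
    exists f, alike x x' (2 * j.+1) f a a'.
  by case=> f aa'; exists f; apply: alike_widen aa'; lia.
case: o => [v|v|u v|u v|a] /=.
- have [f sv] := ss' v.
  by apply: alike_carry jm sv _ _ => i; apply: tnth_word_inc.
- have [f sv] := ss' v.
  by apply: alike_carry jm sv _ _ => i; apply: tnth_word_dec.
- have [f su] := ss' u; have [g sv] := ss' v.
  by apply: widen; apply: alike_and su sv.
- have [f su] := ss' u; have [g sv] := ss' v.
  by apply: widen; apply: alike_or su sv.
- by apply: widen; apply: alike_operand.
Qed.

Lemma alike_lt j f g a a' b b' :
    j < m -> alike x x' (2 * j) f a a' -> alike x x' (2 * j) g b b' ->
    (f == Some false) || (g == Some true) -> f != g ->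
  uint a < uint b /\ uint a' < uint b'.
Proof.
move=> jm [_ ahi] [_ bhi] fg nfg; have [f0 g1 le_fg] := odflt_lt fg nfg.
have [i [ij _ xi x'i]] := fresh_pair jm (f == Some false).
have [ai a'i] := ahi i ij; have [bi b'i] := bhi i ij.
split; apply: (@uint_lt _ _ _ (2 * j) i) => //;
  rewrite ?ai ?a'i ?bi ?b'i ?xi ?x'i ?f0 //.
- by move=> l jl; have [-> _] := ahi l jl; have [-> _] := bhi l jl; apply: le_fg.
- by move=> l jl; have [_ ->] := ahi l jl; have [_ ->] := bhi l jl; apply: le_fg.
Qed.

(** Different shapes are strictly ordered, the same way in both runs. For equal shapes the high
    parts of the two operands cancel, leaving low parts that both runs share. *)
Lemma alike_comparison j c f g a a' b b' :
    j < m -> alike x x' (2 * j) f a a' -> alike x x' (2 * j) g b b' ->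
  eval_comparison c a b = eval_comparison c a' b'.
Proof.
move=> jm aa' bb'; have [fg|nfg] := eqVneq f g; last first.
  have [l|l] : (f == Some false) || (g == Some true) \/
               (g == Some false) || (f == Some true).
    by case: f g nfg {aa' bb'} => [[]|] [[]|]; auto.
  - by have [lt lt'] := alike_lt jm aa' bb' l nfg; case: c => /=; lia.
  - rewrite eq_sym in nfg; have [lt lt'] := alike_lt jm bb' aa' l nfg.
    by case: c => /=; lia.
move: aa' bb'; rewrite -{}fg => -[alo ahi] [blo bhi].
have lo_eq (u v : word n) : (forall i : 'I_n, i < 2 * j -> tnth u i = tnth v i) ->
    \sum_(i < n | i < 2 * j) tnth u i * 2 ^ i =
    \sum_(i < n | i < 2 * j) tnth v i * 2 ^ i.
  by move=> uv; apply: eq_bigr => i /uv ->.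
have hi_eq (u v : word n) : (forall i : 'I_n, 2 * j <= i -> tnth u i = tnth v i) ->
    \sum_(i < n | 2 * j <= i) tnth u i * 2 ^ i =
    \sum_(i < n | 2 * j <= i) tnth v i * 2 ^ i.
  by move=> uv; apply: eq_bigr => i /uv ->.
have := uint_split a (2 * j); have := uint_split b (2 * j).
have := uint_split a' (2 * j); have := uint_split b' (2 * j).
rewrite (lo_eq a a' alo) (lo_eq b b' blo) (hi_eq a b) ?(hi_eq a' b').
- by case: c => /=; lia.
- by move=> i ij; have [_ ->] := ahi i ij; have [_ ->] := bhi i ij.
- by move=> i ij; have [-> _] := ahi i ij; have [-> _] := bhi i ij.
Qed.

(** Here [j] counts the operations already executed. Each further one uses up a pair, and
    [j + t < m] leaves an untouched pair for every operation and comparison to come. *)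
Lemma alike_exec P pc s t w j s' :
    exec P pc s t w -> j + t < m -> alike_store x x' (2 * j) s s' ->
  exists f w', exec P pc s' t w' /\ alike x x' (2 * (j + t)) f w w'.
Proof.
move=> ex; elim: ex j s' => {pc s t w}
  [pc s t w d o E _ IH|pc s t w c a b l1 l2 E _ IH|pc s v E] j s' jm ss'.
- have j1m : j.+1 + t < m by rewrite addSnnS.
  case: (IH j.+1 (update s' d (eval_operation s' o)) j1m) => [v|f [w' [ex ww']]].
    rewrite /update; case: (v == d).
      by apply: alike_operation ss'; lia.
    by have [f sv] := ss' v; exists f; apply: alike_widen sv; lia.
  by exists f, w'; rewrite -addSnnS; split=> //; apply: ExecOp E ex.
- have [f [w' [ex ww']]] := IH j s' jm ss'.
  exists f, w'; split=> //; apply: (ExecBranch E).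
  have [g aa] := alike_operand a ss'; have [h bb] := alike_operand b ss'.
  by rewrite -(alike_comparison c _ aa bb) //; lia.
- have [f sv] := ss' v; exists f, (s' v); rewrite addn0.
  by split=> //; apply: ExecOutput.
Qed.

Lemma alike_runs P t w :
    runs P x t w -> t < m ->
  exists f w', runs P x' t w' /\ alike x x' (2 * t) f w w'.
Proof.
move=> ex tm; apply: (@alike_exec P 0 _ _ _ 0 _ ex) => // v.
rewrite /init; case: (v == 0); first by exists None; apply: alike_input.
by exists (Some false); apply: alike0.
Qed.

End TwoInputs.

(** * The hard inputs and the lower bound *)

(** The top bit [c] is kept apart from the filling [b] so that it can be flipped alone. *)
Definition paired_word n m (b c : bool) : word n :=
  [tuple if i < 2 * m then odd i else if i < n.-1 then b else c | i < n].

Lemma nu_sum n (x : word n) : nu x = \sum_(i < n) tnth x i.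
Proof.
rewrite /nu -sum1_count big_mkcond big_tuple.
by apply: eq_bigr => i _; case: (tnth x i).
Qed.

Lemma nu_paired_word n m b c :
  2 * m < n -> nu (paired_word n m b c) = m + (n.-1 - 2 * m) * b + c.
Proof.
move=> mn; rewrite nu_sum; under eq_bigr do rewrite tnth_mktuple.
case: n mn => // n; rewrite ltnS /= => mn.
rewrite big_ord_recr /= ltnn ltnNge mn /=; congr (_ + _).
rewrite -(big_mkord xpredT (fun i : nat => nat_of_bool
  (if i < 2 * m then odd i else if i < n then b else c))).
rewrite (big_cat_nat (n := 2 * m)) //=; congr (_ + _).
  rewrite (eq_big_nat _ _ (F2 := fun i => nat_of_bool (odd i))); last first.
    by move=> i /andP[_ ->].
  elim: (m) => [|q IH]; first by rewrite big_geq.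
  by rewrite mulnS !addSn add0n !big_nat_recr //= IH oddM /=; lia.
rewrite (eq_big_nat _ _ (F2 := fun=> nat_of_bool b)); last first.
  by move=> i /andP[mi ->]; rewrite ltnNge mi.
by rewrite sum_nat_const_nat.
Qed.

Theorem theorem1 (n : nat) (hn : 1 < n) (P : program) (hP : computes_nu n P)
    (k : nat) (hk : k <= n) (hk2 : 2 * k <> n) :
  exists x : word n,
    nu x = k /\ exists t w, runs P x t w /\ minn k (n - k) <= t.
Proof.
(* The filling is the majority bit: [m = k] pairs and zeros, or [m = n - k] pairs and ones, give [k]
   ones in either case. *)
pose m := minn k (n - k); pose b := n < 2 * k.
(* Strict since [2 * k <> n]; hence the top bit lies above all pairs. *)
have mn : 2 * m < n by rewrite /m; lia.
exists (paired_word n m b b); split.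
  by rewrite nu_paired_word // /m /b; case: (ltnP n (2 * k)) => /=; lia.
have [t [w [run out]]] := hP (paired_word n m b b).
exists t, w; split=> //; rewrite -/m leqNgt; apply/negP => tm.
have pairs c (i : 'I_n) : i < 2 * m -> tnth (paired_word n m b c) i = odd i.
  by move=> im; rewrite tnth_mktuple im.
have [f [w' [run' [lo hi]]]] :=
  alike_runs (ltnW mn) (pairs b) (pairs (~~ b)) run tm.
have [t2 [w2 [run2 out']]] := hP (paired_word n m b (~~ b)).
have [_ eq_w] := exec_deterministic run2 run'; rewrite {}eq_w in out'.
rewrite !nu_paired_word // in out out'.
(* A constant shape makes both outputs equal, although the two counts differ by one. *)
case: f hi => [c|] hi.
  have ww' : w = w'.
    apply: eq_from_tnth => i; case: (ltnP i (2 * t)) => [/lo //|/hi[-> ->] //].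
  by move: out out'; rewrite ww'; case: (b) => /=; lia.
have top : n.-1 < n by lia.
have [] := hi (Ordinal top); first by rewrite /=; lia.
have -> : forall c, odflt (tnth (paired_word n m b c) (Ordinal top)) None = c.
  by move=> c; rewrite /= tnth_mktuple /= ltnn ltnNge -ltnS prednK ?mn //; lia.
rewrite /= tnth_mktuple /= ltnn ltnNge -ltnS prednK ?mn //=; last by lia.
(* Whichever input has top bit 1 has [n - m] or [m + 1] ones, at most [n.-1] since [0 < m] and
   [2 * m < n]; its output is at least [2 ^ n.-1]. *)
have big : n.-1 < 2 ^ n.-1 by apply: ltn_expl.
case: (b) out out' => out out' wn w'n.
  by have := uint_ge_bit wn; rewrite /= out; lia.
by have := uint_ge_bit w'n; rewrite /= out'; lia.
Qed.
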